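(* Let $\mathcal{A}\subset K[x_1,\ldots,x_n]$ be a $K$-subalgebra that admits a finite Sagbi basis with respect to every global monomial ordering. Let $S_{old}=\{g_1,\ldots,g_t\}$ be a (monic) Sagbi basis of $\mathcal{A}$ with respect to a global monomial ordering $>_{old}$. Let $\mathbf{w}_{new}$ be any weight vector in the Sagbi cone $C_{old}=C_{S_{old},>_{old}}$, and let $>_{new}$ be the ordering represented by $(\mathbf{w}_{new},M_t)$, where $M_t\in GL(n,\mathbb{R})$ is a matrix representing a global monomial ordering $>_t$. Let $H=\{h_1,\ldots,h_s\}$ be the monic Sagbi basis of $in_{\mathbf{w}_{new}}(S_{old})$ with respect to $>_{new}$. Express each $h_j\in H$ as $$h_j=P_j\big(In_{\mathbf{w}_{new}}(g_1),\ldots,In_{\mathbf{w}_{new}}(g_t)\big),\qquad P_j\in K[y_1,\ldots,y_t].$$ Then, replacing the initial forms by the $g_i$ themselves, the polynomials $$\overline h_j=P_j(g_1,\ldots,g_t),\qquad 1\le j\le s,$$ form a Sagbi basis of $\mathcal{A}$ with respect to $>_{new}$.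
   Context: $K$ is a field. For a subset $G\subset K[x_1,\ldots,x_n]$, $K[G]$ denotes the $K$-subalgebra generated by $G$. A monomial ordering is a total ordering on the monomials $x^\alpha$, $\alpha\in\mathbb{N}^n$, compatible with multiplication; it is global if $x^\alpha>1$ for all $\alpha\neq0$. $LM_>(f)$ is the leading monomial of a nonzero $f$, $L_>(G)=\{LM_>(f): f\in G\setminus\{0\}\}$ and $in_>(G)=K[L_>(G)]$. A subset $S\subset\mathcal{A}$ is a Sagbi basis of the subalgebra $\mathcal{A}$ with respect to $>$ if $in_>(\mathcal{A})=K[L_>(S)]$. A set is monic if all its leading coefficients equal $1$. For $M\in GL(n,\mathbb{R})$, $x^\alpha>_M x^\beta$ iff $M\alpha>M\beta$ in the lexicographic order on $\mathbb{R}^n$. The ordering represented by $(\mathbf{w},M_t)$ first compares $\mathbf{w}$-degrees $deg_{\mathbf{w}}(x^\alpha)=\mathbf{w}\cdot\alpha$ and breaks ties using $>_{M_t}$. For $f=\sum a_\alpha x^\alpha\ne0$, $In_{\mathbf{w}}(f)$ is the sum of all terms $a_\alpha x^\alpha$ of $f$ ($a_\alpha\neq 0$) of maximal $\mathbf{w}$-degree; $In_{\mathbf{w}}(0)=0$. For a set $G$, $In_{\mathbf{w}}(G)=\{In_{\mathbf{w}}(f): f\in G\}$ and $in_{\mathbf{w}}(G)=K[In_{\mathbf{w}}(G)]$. Sagbi cone: if $S=\{g_1,\ldots,g_t\}$ is a Sagbi basis with respect to $>$ with $g_i=x^{\alpha(i)}+\sum_\beta c_{i,\beta}x^\beta$,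 $x^{\alpha(i)}=LT_>(g_i)$ and $x^{\alpha(i)}>x^\beta$ whenever $c_{i,\beta}\neq0$, then $$C_{S,>}=\{\mathbf{w}\in(\mathbb{R}^n)^+ : \alpha(i)\cdot\mathbf{w}\ge\beta\cdot\mathbf{w}\ \text{ whenever } c_{i,\beta}\ne0\},$$ where $(\mathbb{R}^n)^+$ is the set of vectors with nonnegative entries.
   Formalization: The expressions P_j are required to have no term whose w_new-degree at the initial forms exceeds that of h_j (such P_j are proved to exist); for arbitrary P_j the claim fails, e.g. S_old={x, x^2+x}, w=1, P=y_1-(y_2-y_1^2) gives 0. *)

(* Defs.v *)
From mathcomp Require Import all_boot all_order all_algebra.
From mathcomp Require Import mpoly.
From mathcomp Require Import classical_sets reals.

Set Implicit Arguments.
Unset Strict Implicit.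
Unset Printing Implicit Defensive.

Import Order.TTheory GRing.Theory Num.Theory.

Local Open Scope classical_set_scope.
Local Open Scope ring_scope.

(* Orderings are given by their strict part: [gt a b] reads x^a > x^b. *)
Definition monomial_ordering (n : nat) (gt : rel 'X_{1..n}) : Prop :=
  [/\ irreflexive gt, transitive gt,
      (forall a b, a != b -> gt a b || gt b a)
    & (forall a b c, gt a b -> gt (a + c)%MM (b + c)%MM)].

Definition global_ordering (n : nat) (gt : rel 'X_{1..n}) : Prop :=
  monomial_ordering gt /\ (forall a, a != 0%MM -> gt a 0%MM).

Definition expv (R : realType) (n : nat) (a : 'X_{1..n}) : 'cV[R]_n :=
  \col_i (a i)%:R.

Definition gt_lex (R : realType) (n : nat) (u v : 'cV[R]_n) : bool :=
  [exists i : 'I_n, (v i 0 < u i 0) &&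
     [forall j : 'I_n, (j < i)%N ==> (u j 0 == v j 0)]].

Definition gt_mx (R : realType) (n : nat) (M : 'M[R]_n) : rel 'X_{1..n} :=
  fun a b => gt_lex (M *m expv R a) (M *m expv R b).

Definition wdeg (R : realType) (n : nat) (w : 'rV[R]_n) (a : 'X_{1..n}) : R :=
  \sum_i w 0 i * (a i)%:R.

Definition gt_weight (R : realType) (n : nat) (w : 'rV[R]_n) (M : 'M[R]_n) :
    rel 'X_{1..n} :=
  fun a b => (wdeg w b < wdeg w a)
          || (wdeg w a == wdeg w b) && gt_mx M a b.

(* Maximal w-degree of a term. The default value 0 is harmless when w has
   nonnegative entries, which is the only case where this is used; in
   particular the zero polynomial has w-degree 0. *)
Definition wdegp (R : realType) (K : fieldType) (n : nat) (w : 'rV[R]_n)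
    (f : {mpoly K[n]}) : R :=
  \big[Num.max/0]_(a <- msupp f) wdeg w a.

Definition is_subalg (K : fieldType) (n : nat) (A : set {mpoly K[n]}) : Prop :=
  [/\ A 1,
      (forall (c : K) f g, A f -> A g -> A (c *: f + g))
    & (forall f g, A f -> A g -> A (f * g))].

(* K[G] *)
Definition gen_alg (K : fieldType) (n : nat) (G : set {mpoly K[n]}) :
    set {mpoly K[n]} :=
  smallest (@is_subalg K n) G.

(* x^a is the leading monomial of f; no such a exists for f = 0. *)
Definition is_lead (K : fieldType) (n : nat) (gt : rel 'X_{1..n})
    (f : {mpoly K[n]}) (a : 'X_{1..n}) : Prop :=
  a \in msupp f /\ (forall b, b \in msupp f -> b != a -> gt a b).

Definition lead_monomials (K : fieldType) (n : nat) (gt : rel 'X_{1..n})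
    (G : set {mpoly K[n]}) : set {mpoly K[n]} :=
  [set p | exists f a, [/\ G f, is_lead gt f a & p = 'X_[a]]].

Definition initial_alg (K : fieldType) (n : nat) (gt : rel 'X_{1..n})
    (G : set {mpoly K[n]}) : set {mpoly K[n]} :=
  gen_alg (lead_monomials gt G).

Definition sagbi_basis (K : fieldType) (n : nat) (gt : rel 'X_{1..n})
    (A S : set {mpoly K[n]}) : Prop :=
  S `<=` A /\ initial_alg gt A = gen_alg (lead_monomials gt S).

Definition monic_set (K : fieldType) (n : nat) (gt : rel 'X_{1..n})
    (S : set {mpoly K[n]}) : Prop :=
  forall f, S f -> exists2 a, is_lead gt f a & f@_a = 1.

Definition initial_form (R : realType) (K : fieldType) (n : nat)
    (w : 'rV[R]_n) (f : {mpoly K[n]}) : {mpoly K[n]} :=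
  \sum_(a <- msupp f | all (fun b => wdeg w b <= wdeg w a) (msupp f))
     f@_a *: 'X_[a].

Definition weight_initial_alg (R : realType) (K : fieldType) (n : nat)
    (w : 'rV[R]_n) (G : set {mpoly K[n]}) : set {mpoly K[n]} :=
  gen_alg (initial_form w @` G).

Definition sagbi_cone (R : realType) (K : fieldType) (n : nat)
    (S : set {mpoly K[n]}) (gt : rel 'X_{1..n}) : set 'rV[R]_n :=
  [set w : 'rV[R]_n | (forall i, 0 <= w 0 i) /\
           (forall f a b, S f -> is_lead gt f a -> b \in msupp f ->
              wdeg w b <= wdeg w a)].

(* h = P(In_w(g_1), ..., In_w(g_t)), where no term of P contributes in w-degree
   higher than that of h. The degree condition is needed: for
   g = (x, x^2 + x), w = 1 and h = x, the polynomial P = y_1 - (y_2 - y_1^2)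
   satisfies P(In_w(g_1), In_w(g_2)) = h but P(g_1, g_2) = 0. *)
Definition expresses (R : realType) (K : fieldType) (n t : nat)
    (w : 'rV[R]_n) (g : t.-tuple {mpoly K[n]}) (P : {mpoly K[t]})
    (h : {mpoly K[n]}) : Prop :=
  let Ing := [tuple of map (initial_form w) g] in
  h = P \mPo Ing /\
  (forall c, c \in msupp P -> wdegp w ('X_[c] \mPo Ing) <= wdegp w h).

(* Main.v *)
Require Import Defs.
From HB Require Import structures.
From mathcomp Require Import all_boot all_order all_algebra.
From mathcomp Require Import mpoly.
From mathcomp Require Import classical_sets reals boolp.
From mathcomp Require Import lra.

(** Write $w$ for the new weight, $A$ for the algebra and $B = K[In_w(g)]$ for
    the algebra of initial forms. Give the variable $y_i$ of $K[y_1,...,y_t]$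
    the weight $\deg_w(g_i)$. Since $w$-degrees add up and top-degree parts
    multiply, $g^c$ and $In_w(g)^c$ have the same part in degree the weight of
    $c$, and nothing above it ([wpart_mpolyX_comp]). Hence, if all the terms of
    $Q$ have weight at most $d$, then $Q(g)$ and $Q(In_w(g))$ live in
    $w$-degrees at most $d$ and have the same part of degree $d$
    ([wpart_comp]). The new ordering compares $w$-degrees first, so a leading
    monomial of $w$-degree $d$ is shared by both polynomials
    ([gt_weight_lead_transfer]).

    This transfer is used in both directions. From $B$ to $A$: an expression
    of $h_j$ bounded in weight by its degree gives $P_j(g)$ in $A$ with the
    leading monomial of $h_j$. Such expressions exist because the products
    $In_w(g)^c$ are $w$-homogeneous, so the terms of excessive weight in any
    expression of $h_j$ cancel and can be dropped ([comp_init_truncate]). From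
    $A$ to $B$: each $f$ in $A$ must be written as $Q(g)$ with the weights in
    $Q$ at most $\deg_w(f)$. That is what subduction with respect to the old
    ordering produces ([subduction]): the cone condition says that the old
    leading monomial of $g^c$ has the largest $w$-degree in $g^c$, so that
    subtracting a multiple of $g^c$ to cancel the old leading monomial of $f$
    never raises the $w$-degree. Subduction terminates since global orderings
    are well-founded, by Dickson's lemma ([global_ordering_wf]).

    Consequently the leading monomials of $A$ are among those of $B$, hence in
    the algebra generated by those of the $h_j$, which are leading monomials
    of the $P_j(g)$. *)

Set Implicit Arguments.
Unset Strict Implicit.
Unset Printing Implicit Defensive.

Import Order.TTheory GRing.Theory Num.Theory.

Local Open Scope classical_set_scope.
Local Open Scope ring_scope.

(** * Global monomial orderings are well-founded *)

(** Take for each index of the subsequence a place where the smallest value of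
    the tail beyond the previous index is reached. *)
Lemma nat_seq_nondecreasing_subseq (u : nat -> nat) :
  exists phi : nat -> nat, {homo phi : i j / (i < j)%N} /\
    {homo u \o phi : i j / (i <= j)%N}.
Proof.
have tail_min N : exists m, (N <= m)%N /\ forall k, (N <= k)%N -> (u m <= u k)%N.
  have exP : exists v, `[< exists2 m, (N <= m)%N & u m = v >].
    by exists (u N); apply/asboolP; exists N.
  case: (ex_minnP exP) => v /asboolP[m Nm <-] vmin.
  by exists m; split=> // k Nk; apply: vmin; apply/asboolP; exists k.
have [m mP] := choice tail_min.
pose phi := fix phi k := if k is k'.+1 then m (phi k').+1 else m 0%N.
have mphi k : exists2 N, phi k = m N & (N <= phi k)%N.
  by case: k => [|k]; eexists; try reflexivity; exact: (mP _).1.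
exists phi; split.
  by apply: homo_ltn => [? ? ?|k]; [exact: ltn_trans | exact: (mP _).1].
apply: homo_leq => [//|? ? ?|k] /=; first exact: leq_trans.
have [N -> Nphi] := mphi k; apply: (mP N).2.
exact: leq_trans (leq_trans Nphi (leqnSn _)) (mP _).1.
Qed.

(** Extracting successively for each coordinate works because a subsequence of
    a nondecreasing sequence is nondecreasing. *)
Lemma mnm_seq_nondecreasing_subseq (n : nat) (u : nat -> 'X_{1..n})
    (s : seq 'I_n) :
  exists phi : nat -> nat, {homo phi : i j / (i < j)%N} /\
    forall l, l \in s -> {homo (fun k => u (phi k) l) : i j / (i <= j)%N}.
Proof.
elim: s => [|l s [phi [phi_incr phi_mono]]].
  by exists id; split=> [//|?]; rewrite in_nil.
have [psi [psi_incr psi_mono]] :=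
  nat_seq_nondecreasing_subseq (fun k => u (phi k) l).
exists (phi \o psi); split=> [i j ij|l'] /=; first by apply/phi_incr/psi_incr.
rewrite inE => /predU1P[-> //|l's] i j ij /=; apply: phi_mono => //.
by case: (ltngtP i j) ij => // [/psi_incr/ltnW|->].
Qed.

Lemma dickson (n : nat) (u : nat -> 'X_{1..n}) :
  exists i j, (i < j)%N /\ (u i <= u j)%MM.
Proof.
have [phi [phi_incr phi_mono]] := mnm_seq_nondecreasing_subseq u (enum 'I_n).
exists (phi 0%N), (phi 1%N); split; first exact: phi_incr.
by apply/mnm_lepP => l; apply: (phi_mono l) => //; rewrite mem_enum.
Qed.

(** A failure of accessibility yields an infinite strictly descending sequence
    $u$. Dickson's lemma gives $i < j$ with $u_i$ dividing $u_j$, and a multiple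
    of $u_i$ is never smaller than $u_i$ in a global ordering. *)
Lemma global_ordering_wf (n : nat) (gt : rel 'X_{1..n}) :
  global_ordering gt -> well_founded (fun b a => gt a b).
Proof.
move=> [[gt_irr gt_tr _ gt_add] gt0] a; apply: contrapT => nacc_a.
pose T := {b : 'X_{1..n} | ~ Acc (fun b a => gt a b) b}.
have next (b : T) : exists c : T, gt (sval b) (sval c).
  case: b => b nacc_b /=; apply: contrapT => no_next; apply: nacc_b.
  constructor => c gt_bc; apply: contrapT => nacc_c.
  by apply: no_next; exists (exist _ c nacc_c).
have [f fP] := choice next.
pose u k := sval (iter k f (exist _ a nacc_a : T)).
have u_desc : {homo u : i j / (i < j)%N >-> gt i j}.
  by apply: homo_ltn => [y x z|k]; [exact: gt_tr | exact: fP].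
have [i [j [ij le_uij]]] := dickson u.
have := u_desc _ _ ij; rewrite -(submK le_uij).
have [->|/gt0 gt_m] := eqVneq (u j - u i)%MM 0%MM.
  by rewrite add0m gt_irr.
move=> gt_ui; have := gt_add _ _ (u i) gt_m; rewrite add0m => gt_m_ui.
by have := gt_tr _ _ _ gt_ui gt_m_ui; rewrite gt_irr.
Qed.

(** * Parts of a polynomial supported on a set of monomials *)

Section MonomialPart.
Context {K : fieldType} {n : nat}.
Implicit Types (T U : pred 'X_{1..n}) (f : {mpoly K[n]}) (a b : 'X_{1..n}).

Definition mpart T f : {mpoly K[n]} :=
  \sum_(a <- msupp f | T a) f@_a *: 'X_[a].

Lemma mcoeff_mpart T f a : (mpart T f)@_a = if T a then f@_a else 0.
Proof.
rewrite /mpart raddf_sum /= big_mkcond /=.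
under eq_bigr => b _ do
  rewrite mcoeffZ mcoeffX (fun_if (fun x : K => x)).
have [fa0|fa] := eqVneq f@_a 0.
  rewrite fa0 if_same big1_seq // => b /andP[_ bf].
  case: ifP => // _; case: eqP => [ba|_]; last by rewrite mulr0.
  by rewrite ba fa0 mul0r.
rewrite (bigD1_seq a) ?msupp_uniq ?mcoeff_msupp //= eqxx mulr1.
rewrite big1 ?addr0 // => b /negPf->; rewrite mulr0; exact: if_same.
Qed.

Lemma mpart_is_linear T : linear (mpart T).
Proof.
move=> c f g; apply/mpolyP => a.
rewrite mcoeffD mcoeffZ !mcoeff_mpart mcoeffD mcoeffZ.
by case: ifP; rewrite // mulr0 addr0.
Qed.

HB.instance Definition _ T :=
  GRing.isLinear.Build K {mpoly K[n]} {mpoly K[n]} _ (mpart T)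
    (mpart_is_linear T).

Lemma mpartX T a : mpart T 'X_[a] = if T a then 'X_[a] else 0.
Proof.
rewrite /mpart msuppX big_mkcond big_seq1.
by case: ifP; rewrite // mcoeffX eqxx scale1r.
Qed.

Lemma mpart_id T f : (forall a, a \in msupp f -> T a) -> mpart T f = f.
Proof.
move=> Tf; apply/mpolyP => a; rewrite mcoeff_mpart.
case: ifP => // /negP nTa; apply/esym/eqP; apply: contra_notT nTa.
by rewrite -mcoeff_msupp => /Tf.
Qed.

Lemma mpart0 T f : (forall a, a \in msupp f -> ~~ T a) -> mpart T f = 0.
Proof.
move=> Tf; apply/mpolyP => a; rewrite mcoeff_mpart mcoeff0.
case: ifP => // Ta; apply/eqP; apply: contraTT Ta.
by rewrite -mcoeff_msupp => /Tf.
Qed.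

Lemma msupp_mpart T f a : (a \in msupp (mpart T f)) = T a && (a \in msupp f).
Proof.
by rewrite !mcoeff_msupp mcoeff_mpart; case: ifP => _ //=; rewrite eqxx.
Qed.

(** The common source of the multiplicativity of top-degree parts (with [T1],
    [T2], [U] the exponents of given weights) and of leading terms (with
    singletons): in the expansion of $fg$, a product of two terms contributes
    to [U] exactly when its factors come from [T1] and [T2]. *)
Lemma mpartM T1 T2 U f g :
  (forall a b, a \in msupp f -> b \in msupp g -> U (a + b)%MM = T1 a && T2 b) ->
  mpart U (f * g) = mpart T1 f * mpart T2 g.
Proof.
move=> UE; rewrite {1}[f]mpolyE {1}[g]mpolyE big_distrlr /= [RHS]big_distrlr /=.
rewrite raddf_sum [RHS]big_mkcond; apply: eq_big_seq => a af.
rewrite raddf_sum /=; case: ifP => Ta; last first.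
  rewrite big1_seq // => b /andP[_ bg].
  by rewrite -scalerAl -scalerAr -mpolyXD !linearZ /= mpartX UE // Ta /= !scaler0.
rewrite [RHS]big_mkcond; apply: eq_big_seq => b bg.
rewrite -scalerAl -scalerAr -mpolyXD !linearZ /= mpartX UE // Ta /=.
by case: ifP => _; [rewrite !scalerA mulrC | rewrite !scaler0].
Qed.

Lemma msuppMP f g (a : 'X_{1..n}) : a \in msupp (f * g) ->
  exists b c, [/\ b \in msupp f, c \in msupp g & a = (b + c)%MM].
Proof. by move/msuppM_le/allpairsP => [[b c] /= [? ? ->]]; exists b, c. Qed.

End MonomialPart.

(** * Leading monomials *)

Section Lead.
Context {K : fieldType} {n : nat}.
Implicit Types (gt : rel 'X_{1..n}) (f g : {mpoly K[n]}) (a b : 'X_{1..n}).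

Lemma ex_is_lead gt f : monomial_ordering gt -> f != 0 ->
  exists a, is_lead gt f a.
Proof.
move=> [_ gt_tr gt_tot _]; rewrite -msupp_eq0 /is_lead.
elim: (msupp f) => // a s IHs _; have [->|/IHs [m [ms m_max]]] := eqVneq s [::].
  by exists a; split=> [|b]; rewrite inE // => /eqP->; rewrite eqxx.
have [->|/gt_tot/orP[gt_am|gt_ma]] := eqVneq a m.
- exists m; split=> [|b]; first exact: mem_head.
  by rewrite inE => /predU1P[->|/m_max//]; rewrite eqxx.
- exists a; split=> [|b]; first exact: mem_head.
  rewrite inE => /predU1P[->|bs _]; first by rewrite eqxx.
  by have [->//|/(m_max _ bs)] := eqVneq b m; exact: gt_tr.
exists m; split=> [|b]; first by rewrite inE ms orbT.
by rewrite inE => /predU1P[-> //|/m_max].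
Qed.

(** Among the products of a term of $f$ and a term of $g$, only the product of
    the two leading terms can have exponent $a + b$, so it is not cancelled. *)
Lemma is_leadM gt f g a b : monomial_ordering gt ->
  is_lead gt f a -> is_lead gt g b ->
  is_lead gt (f * g) (a + b)%MM /\ (f * g)@_(a + b)%MM = f@_a * g@_b.
Proof.
move=> [gt_irr gt_tr _ gt_add] [af a_max] [bg b_max].
have addmL c d e : gt c d -> gt (e + c)%MM (e + d)%MM.
  by rewrite ![(e + _)%MM]addmC; exact: gt_add.
have gt_ab c d : c \in msupp f -> d \in msupp g -> (c, d) != (a, b) ->
    gt (a + b)%MM (c + d)%MM.
  move=> cf dg; rewrite xpair_eqE negb_and.
  have [->/=|ca _] := eqVneq c a; first by move/(b_max _ dg)/addmL.
  have gt_ac := gt_add _ _ b (a_max _ cf ca).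
  by have [->//|/(b_max _ dg)/(addmL _ _ c)] := eqVneq d b; exact: gt_tr.
have coefE : (f * g)@_(a + b)%MM = f@_a * g@_b.
  have singleton c h : mpart (pred1 c) h = h@_c *: 'X_[c] :> {mpoly K[n]}.
    apply/mpolyP => d; rewrite mcoeff_mpart mcoeffZ mcoeffX /= eq_sym.
    by case: eqP => [->|_]; rewrite ?mulr1 ?mulr0.
  have partE : mpart (pred1 (a + b)%MM) (f * g)
      = mpart (pred1 a) f * mpart (pred1 b) g.
    apply: mpartM => c d cf dg; rewrite -[RHS]/((c, d) == (a, b)).
    have [[-> ->]|/(gt_ab _ _ cf dg) gt_cd] := eqVneq (c, d).
      exact: eqxx.
    by apply: contraTF gt_cd => /eqP->; rewrite gt_irr.
  move: partE; rewrite !singleton -scalerAl -scalerAr -mpolyXD scalerA.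
  by move=> /(congr1 (mcoeff (a + b)%MM)); rewrite !mcoeffZ mcoeffX eqxx !mulr1.
split=> //; split=> [|c].
  by rewrite mcoeff_msupp coefE mulf_neq0 // -mcoeff_msupp.
move=> /msuppMP[d [e [df eg ->]]] ne; apply: gt_ab => //.
by apply: contraNneq ne => -[-> ->].
Qed.

End Lead.

(** * Weights *)

Section Weight.
Context {R : realType} {K : fieldType} {n : nat}.
Variable w : 'rV[R]_n.
Implicit Types (f g : {mpoly K[n]}) (a b : 'X_{1..n}) (d e : R).

Lemma wdeg0 : wdeg w 0%MM = 0.
Proof. by rewrite /wdeg big1 // => i _; rewrite mnm0E mulr0. Qed.

Lemma wdegD a b : wdeg w (a + b)%MM = wdeg w a + wdeg w b.
Proof.
rewrite /wdeg -big_split /=; apply: eq_bigr => i _.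
by rewrite mnmDE natrD mulrDr.
Qed.

(** A bound on the support rather than on [wdegp], so that the zero polynomial
    satisfies every bound, negative ones included. *)
Definition wdeg_le d f : Prop := forall a, a \in msupp f -> wdeg w a <= d.

Definition wpart d f : {mpoly K[n]} := mpart (fun a => wdeg w a == d) f.

Lemma wdeg_le_trans d e f : d <= e -> wdeg_le d f -> wdeg_le e f.
Proof. by move=> de fd a /fd /le_trans; apply. Qed.

Lemma wdeg_leB d f g : wdeg_le d f -> wdeg_le d g -> wdeg_le d (f - g).
Proof.
by move=> fd gd a /msuppB_le; rewrite mem_cat => /orP[/fd|/gd].
Qed.

Lemma wdeg_leZ d c f : wdeg_le d f -> wdeg_le d (c *: f).
Proof. by move=> fd a /msuppZ_le/fd. Qed.

Lemma wpart_wdeg_le d f : wdeg_le d (wpart d f).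
Proof. by move=> a; rewrite msupp_mpart => /andP[/eqP->]. Qed.

Lemma wpart_idem d f : wpart d (wpart d f) = wpart d f.
Proof. by apply: mpart_id => a; rewrite msupp_mpart => /andP[]. Qed.

Lemma wpart_lt d e f : e < d -> wdeg_le e f -> wpart d f = 0.
Proof.
by move=> ed fe; apply: mpart0 => a /fe ae; rewrite lt_eqF // (le_lt_trans ae).
Qed.

Lemma wpartM d e f g : wdeg_le d f -> wdeg_le e g ->
  wdeg_le (d + e) (f * g) /\ wpart (d + e) (f * g) = wpart d f * wpart e g.
Proof.
move=> fd ge; split=> [a /msuppMP[b [c [bf cg ->]]]|].
  by rewrite wdegD lerD ?fd ?ge.
apply: mpartM => a b /fd ad /ge be; rewrite wdegD.
apply/eqP/andP => [abE|[/eqP-> /eqP->]//].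
by split; rewrite eq_le ?ad ?be /=; [move: be|move: ad]; lra.
Qed.

Lemma wpart1 : wdeg_le 0 (1 : {mpoly K[n]}) /\
  wpart 0 (1 : {mpoly K[n]}) = 1.
Proof.
rewrite -mpolyX0; split=> [a|]; first by rewrite msuppX inE => /eqP->; rewrite wdeg0.
by rewrite /wpart mpartX wdeg0 eqxx.
Qed.

Lemma wpart_prodX t (d : 'I_t -> R) (F : 'I_t -> {mpoly K[n]})
    (c : 'X_{1..t}) : (forall i, wdeg_le (d i) (F i)) ->
  wdeg_le (\sum_i d i * (c i)%:R) (\prod_i F i ^+ c i) /\
  wpart (\sum_i d i * (c i)%:R) (\prod_i F i ^+ c i)
    = \prod_i wpart (d i) (F i) ^+ c i.
Proof.
move=> Fd; pose top e f g := wdeg_le e f /\ wpart e f = g.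
apply: (big_ind3 top) => [|e f g e' f' g' [fe <-] [fe' <-]|i _].
- exact: wpart1.
- exact: wpartM.
elim: (c i) => [|k [IHd IHe]]; first by rewrite mulr0 !expr0; exact: wpart1.
rewrite /top -natr1 mulrDr mulr1 !exprSr -IHe; exact: wpartM.
Qed.

Lemma wdegp_wdeg_le f : wdeg_le (wdegp w f) f.
Proof. by move=> a af; exact: le_bigmax_seq. Qed.

Lemma wdegp_ge0 f : 0 <= wdegp w f.
Proof. exact: bigmax_ge_id. Qed.

Lemma wdegp_le d f : 0 <= d -> wdeg_le d f -> wdegp w f <= d.
Proof.
by move=> d0 fd; rewrite /wdegp big_seq; apply: bigmax_le => // a /fd.
Qed.

Lemma gt_weight_lead_wdeg_le (M : 'M[R]_n) f a :
  is_lead (gt_weight w M) f a -> wdeg_le (wdeg w a) f.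
Proof.
move=> [af a_max] b bf; have [->//|/(a_max _ bf)] := eqVneq b a.
by case/orP => [/ltW //|/andP[/eqP-> _]].
Qed.

(** The ordering compares weights first, hence the leading monomial only depends
    on the part of top weight. *)
Lemma gt_weight_lead_transfer (M : 'M[R]_n) f g a :
  is_lead (gt_weight w M) f a -> wdeg_le (wdeg w a) g ->
  wpart (wdeg w a) f = wpart (wdeg w a) g -> is_lead (gt_weight w M) g a.
Proof.
move=> [af a_max] ga partE.
have suppE b : wdeg w b = wdeg w a -> (b \in msupp f) = (b \in msupp g).
  move=> ba; have := congr1 (fun p : {mpoly K[n]} => b \in msupp p) partE.
  by rewrite /wpart !msupp_mpart ba eqxx.
split=> [|b bg ba]; first by rewrite -suppE.
have := ga _ bg; rewrite le_eqVlt => /predU1P[wba|wba]; last first.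
  by rewrite /gt_weight wba.
by apply: a_max => //; rewrite suppE.
Qed.

Hypothesis w_ge0 : forall i, 0 <= w 0 i.

Lemma wdeg_ge0 a : 0 <= wdeg w a.
Proof. by apply: sumr_ge0 => i _; rewrite mulr_ge0. Qed.

Lemma wdegp_eq f a : a \in msupp f -> wdeg_le (wdeg w a) f ->
  wdegp w f = wdeg w a.
Proof.
move=> af fa; apply/le_anti; rewrite wdegp_le ?wdeg_ge0 //=.
exact: wdegp_wdeg_le.
Qed.

Lemma wdegp_attained f : f != 0 ->
  exists2 a, a \in msupp f & wdeg w a = wdegp w f.
Proof.
rewrite -msupp_eq0 => f0.
have [a af fa] : exists2 a, a \in msupp f & wdeg_le (wdeg w a) f.
  rewrite /wdeg_le; elim: (msupp f) f0 => // a s IHs _.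
  have [->|/IHs [m ms mP]] := eqVneq s [::].
    by exists a => [|b]; rewrite inE // => /eqP->.
  have [ma|am] := leP (wdeg w m) (wdeg w a).
    exists a => [|b]; rewrite inE ?eqxx // => /predU1P[->//|/mP bm].
    exact: le_trans bm ma.
  by exists m => [|b]; rewrite inE ?ms ?orbT // => /predU1P[->|/mP//]; exact: ltW.
by exists a => //; rewrite (wdegp_eq af fa).
Qed.

(** Nonnegativity of the weight makes the default value of [wdegp] harmless. *)
Lemma initial_formE f : initial_form w f = wpart (wdegp w f) f.
Proof.
rewrite /initial_form /wpart /mpart big_seq_cond [RHS]big_seq_cond.
apply: eq_bigl => a; case: (boolP (a \in msupp f)) => //= af.
apply/allP/eqP => [fa|->]; first by rewrite (wdegp_eq af fa).
exact: wdegp_wdeg_le.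
Qed.

Lemma initial_form_neq0 f : f != 0 -> initial_form w f != 0.
Proof.
case/wdegp_attained => a af wa.
by rewrite initial_formE -msupp_eq0; apply/eqP => s0;
   have := msupp_mpart (fun b => wdeg w b == wdegp w f) f a;
   rewrite [msupp _]s0 wa eqxx af.
Qed.

End Weight.

(** * Generated subalgebras *)

Section Subalgebra.
Context {K : fieldType} {n : nat}.
Implicit Types (A G : set {mpoly K[n]}) (f : {mpoly K[n]}).

Lemma gen_alg_is_subalg G : is_subalg (gen_alg G).
Proof.
split=> [B [[]]//|c f g fG gG B BP|f g fG gG B BP].
  by have [[_ + _] _] := BP; apply; [exact: fG | exact: gG].
by have [[_ _ +] _] := BP; apply; [exact: fG | exact: gG].
Qed.

Lemma gen_alg_min G A : is_subalg A -> G `<=` A -> gen_alg G `<=` A.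
Proof. exact: smallest_sub. Qed.

Lemma gen_alg_gen G : G `<=` gen_alg G.
Proof. exact: sub_gen_smallest. Qed.

(** Together with [gen_alg_comp], this describes $K[g_1,...,g_t]$ as the set of
    the polynomial expressions in the $g_i$. *)
Lemma is_subalg_comp A t (g : t.-tuple {mpoly K[n]}) (Q : {mpoly K[t]}) :
  is_subalg A -> (forall i, A (tnth g i)) -> A (Q \mPo g).
Proof.
move=> [A1 A_lin A_mul] Ag.
have A0 : A 0 by rewrite -[0](addNr 1) -scaleN1r; apply: A_lin.
rewrite comp_mpolyE; elim/big_rec: _ => // c f _ Af; apply: A_lin => //.
elim/big_rec: _ => // i h _ Ah; apply: (A_mul) => //.
by elim: (c i) => [|k IHk]; rewrite ?expr0 // exprS; apply: A_mul.
Qed.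

Lemma msupp_comp t (g : t.-tuple {mpoly K[n]}) (Q : {mpoly K[t]}) a :
  a \in msupp (Q \mPo g) ->
  exists2 c, c \in msupp Q & a \in msupp ('X_[c] \mPo g).
Proof.
rewrite comp_mpolyEX big_seq => aQ.
have [//|no_c] := pselect (exists2 c, c \in msupp Q & a \in msupp ('X_[c] \mPo g)).
move: aQ; rewrite mcoeff_msupp raddf_sum big1 ?eqxx // => c cQ.
rewrite /= mcoeffZ; apply/eqP; rewrite mulf_eq0 -[X in _ || X]negbK -mcoeff_msupp.
by apply/orP; right; apply/negP => ac; apply: no_c; exists c.
Qed.

Lemma gen_alg_comp t (g : t.-tuple {mpoly K[n]}) G f :
  (forall p, G p -> exists i, p = tnth g i) -> gen_alg G f ->
  exists Q, f = Q \mPo g.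
Proof.
move=> Gg; move: f; apply: gen_alg_min => [|p /Gg[i ->]]; last first.
  by exists 'X_i; rewrite comp_mpolyXU -tnth_nth.
split=> [|c _ _ [Q ->] [Q' ->]|_ _ [Q ->] [Q' ->]].
- by exists 1; rewrite comp_mpoly1.
- by exists (c *: Q + Q'); rewrite comp_mpolyD comp_mpolyZ.
- by exists (Q * Q'); rewrite rmorphM.
Qed.

(** Polynomials supported on a submonoid [M] form a subalgebra. For an algebra
    generated by monomials, this shows that the monomials it contains are
    products of generators. *)
Lemma gen_alg_msupp (M : set 'X_{1..n}) G f :
  M 0%MM -> (forall a b, M a -> M b -> M (a + b)%MM) ->
  (forall p a, G p -> a \in msupp p -> M a) ->
  gen_alg G f -> forall a, a \in msupp f -> M a.
Proof.
move=> M0 MD GM; move: f.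
apply: (@gen_alg_min _ [set p | forall a, a \in msupp p -> M a]) => [|p Gp a].
  split=> [a|c f g fM gM a|f g fM gM a /msuppMP[b [d [bf dg ->]]]].
  - by rewrite msupp1 inE => /eqP->.
  - by move/msuppD_le; rewrite mem_cat => /orP[/msuppZ_le/fM|/gM].
  - by apply: MD; [exact: fM | exact: gM].
exact: GM.
Qed.

End Subalgebra.

(** * Lifting expressions in the initial forms *)

Section Lift.
Context {R : realType} {K : fieldType} {n t : nat}.
Variables (w : 'rV[R]_n) (g : t.-tuple {mpoly K[n]}).
Hypothesis w_ge0 : forall i, 0 <= w 0 i.

Let Ing := [tuple of map (initial_form w) g].

(** The weight vector on $K[y_1,...,y_t]$ for which the substitution of
    $In_w(g_i)$ for $y_i$ is homogeneous. *)
Definition gen_weight : 'rV[R]_t := \row_i wdegp w (tnth g i).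

Lemma wpart_mpolyX_comp c :
  wdeg_le w (wdeg gen_weight c) ('X_[c] \mPo g) /\
  wpart w (wdeg gen_weight c) ('X_[c] \mPo g) = 'X_[c] \mPo Ing.
Proof.
have [le_c partE] := @wpart_prodX _ _ _ w _ (fun i => wdegp w (tnth g i))
  (tnth g) c (fun i => @wdegp_wdeg_le _ _ _ w _).
have -> : wdeg gen_weight c = \sum_i wdegp w (tnth g i) * (c i)%:R.
  by apply: eq_bigr => i _; rewrite mxE.
rewrite !comp_mpolyX; split=> //; rewrite partE.
by apply: eq_bigr => i _; rewrite tnth_map initial_formE.
Qed.

Lemma wpart_comp d (Q : {mpoly K[t]}) : wdeg_le gen_weight d Q ->
  wdeg_le w d (Q \mPo g) /\ wpart w d (Q \mPo g) = wpart w d (Q \mPo Ing).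
Proof.
move=> Qd; split.
  move=> a /msupp_comp[c cQ ac].
  exact: le_trans ((wpart_mpolyX_comp c).1 a ac) (Qd c cQ).
rewrite !comp_mpolyEX /wpart !raddf_sum; apply: eq_big_seq => c cQ.
rewrite /= !linearZ /=; congr (_ *: _); rewrite -!/(wpart w d _).
have [le_c partE] := wpart_mpolyX_comp c.
have := Qd _ cQ; rewrite le_eqVlt => /predU1P[<-|lt_cd].
  by rewrite -partE wpart_idem.
by rewrite -partE !(wpart_lt lt_cd) //; exact: wpart_wdeg_le.
Qed.

Lemma wdeg_mpolyX_comp_init c a :
  a \in msupp ('X_[c] \mPo Ing) -> wdeg w a = wdeg gen_weight c.
Proof. by rewrite -(wpart_mpolyX_comp c).2 msupp_mpart => /andP[/eqP]. Qed.

Lemma wdeg_le_comp_init d (Q : {mpoly K[t]}) : wdeg_le gen_weight d Q ->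
  wdeg_le w d (Q \mPo Ing).
Proof.
by move=> Qd a /msupp_comp[c cQ /wdeg_mpolyX_comp_init->]; exact: Qd.
Qed.

(** Substituting the initial forms is homogeneous, so the terms of $P$ of weight
    greater than $d$ only contribute in degrees greater than $d$, where the
    result vanishes; dropping them does not change it. *)
Lemma comp_init_truncate d (P : {mpoly K[t]}) : wdeg_le w d (P \mPo Ing) ->
  exists2 Q, wdeg_le gen_weight d Q & P \mPo Ing = Q \mPo Ing.
Proof.
move=> Pd; pose Q := mpart (fun c => wdeg gen_weight c <= d) P.
have Qd : wdeg_le gen_weight d Q by move=> c; rewrite msupp_mpart => /andP[].
exists Q => //; apply/eqP; rewrite -subr_eq0; apply/negPn/negP.
rewrite -msupp_eq0; case supp: (msupp _) => [//|a s] _.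
have aD : a \in msupp ((P \mPo Ing) - (Q \mPo Ing)) by rewrite supp mem_head.
have ad := wdeg_leB Pd (wdeg_le_comp_init Qd) aD.
have DE : (P \mPo Ing) - (Q \mPo Ing) = (P - Q) \mPo Ing by rewrite comp_mpolyB.
move: aD; rewrite DE => /msupp_comp[c cPQ /wdeg_mpolyX_comp_init ac].
move: cPQ; rewrite mcoeff_msupp mcoeffB mcoeff_mpart -ac ad subrr eqxx.
by [].
Qed.

Hypothesis g_neq0 : forall i, tnth g i != 0.

(** A product of nonzero initial forms is nonzero and homogeneous, so the weight
    of $c$ really is its degree. *)
Lemma gen_weight_attained c :
  exists2 a, a \in msupp ('X_[c] \mPo Ing) & wdeg w a = wdeg gen_weight c.
Proof.
have : 'X_[c] \mPo Ing != 0.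
  rewrite comp_mpolyX; apply/prodf_neq0 => i _.
  by rewrite expf_neq0 // tnth_map initial_form_neq0.
rewrite -msupp_eq0; case supp: (msupp _) => [//|a s] _.
have ac : a \in msupp ('X_[c] \mPo Ing) by rewrite supp mem_head.
by exists a; rewrite -?supp ?(wdeg_mpolyX_comp_init ac).
Qed.

(** The degree condition on an expression is a bound on the weights of its
    terms, which is the form that [wpart_comp] needs. *)
Lemma expressesP (P : {mpoly K[t]}) h : expresses w g P h <->
  h = P \mPo Ing /\ wdeg_le gen_weight (wdegp w h) P.
Proof.
split=> -[hE Ph]; split=> // c cP.
  have [a ac <-] := gen_weight_attained c.
  by apply: le_trans (Ph _ cP); exact: wdegp_wdeg_le.
apply: wdegp_le => [|a /wdeg_mpolyX_comp_init->]; first exact: wdegp_ge0.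
exact: Ph.
Qed.

End Lift.

(** * Subduction inside the Sagbi cone *)

Section Subduction.
Context {R : realType} {K : fieldType} {n t : nat}.
Variables (A : set {mpoly K[n]}) (gt : rel 'X_{1..n}).
Variable g : t.-tuple {mpoly K[n]}.
Hypotheses (A_subalg : is_subalg A) (gt_global : global_ordering gt).
Hypothesis g_sagbi : sagbi_basis gt A [set` g].
Hypothesis g_monic : monic_set gt [set` g].
Variable w : 'rV[R]_n.
Hypothesis w_cone : sagbi_cone [set` g] gt w.

Let w_ge0 := w_cone.1.

Lemma monic_tuple_neq0 i : tnth g i != 0.
Proof.
have [|a _ ga] := g_monic (f := tnth g i); first by rewrite /= mem_tnth.
by apply: contra_eq_neq ga => ->; rewrite mcoeff0 eq_sym oner_neq0.
Qed.

(** The exponents $a$ satisfying the conclusion form a submonoid: leading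
    coefficients and leading exponents are multiplicative, and so is the
    property that the leading exponent has the largest weight. It contains the
    leading exponents of the generators by the cone condition, hence all those
    of $A$ by the Sagbi property. *)
Lemma sagbi_lead_monomial f a : A f -> is_lead gt f a -> exists c,
  [/\ is_lead gt ('X_[c] \mPo g) a, ('X_[c] \mPo g)@_a = 1
    & wdeg_le w (wdeg w a) ('X_[c] \mPo g)].
Proof.
move=> Af fa; have gt_mon := gt_global.1.
pose M : set 'X_{1..n} := [set a | exists c,
  [/\ is_lead gt ('X_[c] \mPo g) a, ('X_[c] \mPo g)@_a = 1
    & wdeg_le w (wdeg w a) ('X_[c] \mPo g)]].
have : gen_alg (lead_monomials gt [set` g]) 'X_[a].
  by rewrite -g_sagbi.2; apply: gen_alg_gen; exists f, a.
move/(@gen_alg_msupp _ _ M) => /(_ _ _ _ a); apply; last by rewrite msuppX inE.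
- exists 0%MM; rewrite mpolyX0 comp_mpoly1; split.
  + by split=> [|b]; rewrite msupp1 inE // => /eqP->; rewrite eqxx.
  + by rewrite mcoeff1 eqxx.
  + by move=> b; rewrite msupp1 inE => /eqP->.
- move=> b b' [c [cb cb1 cbw]] [c' [cb' cb'1 cb'w]]; exists (c + c')%MM.
  rewrite mpolyXD rmorphM /=; have [lead coef] := is_leadM gt_mon cb cb'.
  split=> //; first by rewrite coef cb1 cb'1 mulr1.
  by rewrite wdegD; have [] := wpartM cbw cb'w.
move=> p b [f' [b' [f'g lead ->]]]; rewrite msuppX inE => /eqP->.
have [i f'E] := tnthP _ _ f'g; exists U_(i)%MM.
rewrite comp_mpolyXU -tnth_nth -f'E; split=> //.
  (* Monicity speaks of some leading exponent; it is $b'$ by uniqueness. *)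
  have [b'' lead' <-] := g_monic f'g; congr (_@_ _).
  apply/eqP; apply: contraT => bb.
  have gt1 := lead.2 _ lead'.1; have gt2 := lead'.2 _ lead.1.
  have [gt_irr gt_tr _ _] := gt_mon.
  have := gt_tr _ _ _ (gt2 bb) (gt1 _); rewrite gt_irr eq_sym.
  by move=> /(_ bb).
by move=> b'' b''f'; exact: (w_cone.2 _ _ _ f'g lead).
Qed.

(** Cancel the leading monomial of $f$ with a multiple of some $g^c$, and
    iterate on the difference. The leading monomial of $g^c$ being that of $f$ and
    having the largest weight in $g^c$, the bound $d$ is preserved and applies
    to the weight of $c$. *)
Lemma subduction d f : A f -> wdeg_le w d f ->
  exists2 Q, f = Q \mPo g & wdeg_le (gen_weight w g) d Q.
Proof.
have [->|f0] := eqVneq f 0.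
  by exists 0 => [|c]; rewrite ?comp_mpoly0 ?msupp0.
have [a fa] := ex_is_lead gt_global.1 f0.
elim/(well_founded_ind (global_ordering_wf gt_global)): a f {f0} fa
  => a IHa f fa Af fd.
have [c [ca ca1 caw]] := sagbi_lead_monomial Af fa.
pose f' := f - f@_a *: ('X_[c] \mPo g).
have cd : wdeg (gen_weight w g) c <= d.
  (* The weight of $c$ is the weight of a term of $g^c$, and no such term
     outweighs the leading one. *)
  have [b bc <-] := gen_weight_attained w_ge0 monic_tuple_neq0 c.
  apply: le_trans (fd _ fa.1); apply: caw.
  by move: bc; rewrite -(wpart_mpolyX_comp _ w_ge0 c).2 msupp_mpart => /andP[].
have f'd : wdeg_le w d f'.
  apply: wdeg_leB => //; apply: wdeg_leZ.
  by apply: wdeg_le_trans caw; exact: fd fa.1.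
have Af' : A f'.
  have [_ A_lin _] := A_subalg; rewrite /f' addrC -scaleNr; apply: A_lin => //.
  by apply: is_subalg_comp => // i; apply: g_sagbi.1; rewrite /= mem_tnth.
have lift Q : f' = Q \mPo g -> f = (f@_a *: 'X_[c] + Q) \mPo g.
  by rewrite comp_mpolyD comp_mpolyZ => <-; rewrite addrC subrK.
have lift_d Q : wdeg_le (gen_weight w g) d Q ->
    wdeg_le (gen_weight w g) d (f@_a *: 'X_[c] + Q).
  move=> Qd b /msuppD_le; rewrite mem_cat => /orP[/msuppZ_le|/Qd//].
  by rewrite msuppX inE => /eqP->.
suff [Q f'Q Qd] : exists2 Q, f' = Q \mPo g & wdeg_le (gen_weight w g) d Q.
  by exists (f@_a *: 'X_[c] + Q); [exact: lift | exact: lift_d].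
have [->|f'0] := eqVneq f' 0.
  by exists 0 => [|b]; rewrite ?comp_mpoly0 ?msupp0.
have [a' f'a'] := ex_is_lead gt_global.1 f'0.
apply: (IHa a') => //.
have [/eqP a'a|a'a] := boolP (a' == a).
  have := f'a'.1; rewrite a'a mcoeff_msupp mcoeffB mcoeffZ ca1 mulr1 subrr eqxx.
  by [].
have := f'a'.1 => /msuppB_le; rewrite mem_cat => /orP[a'f|/msuppZ_le a'c].
  exact: fa.2.
exact: ca.2.
Qed.

End Subduction.

(** * Sagbi bases along the Sagbi cone *)

Theorem theorem3p3 (R : realType) (K : fieldType) (n : nat)
    (A : set {mpoly K[n]}) (A_subalg : is_subalg A)
    (A_finite : forall gt : rel 'X_{1..n}, global_ordering gt ->
       exists S : seq {mpoly K[n]}, sagbi_basis gt A [set` S])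
    (gt_old : rel 'X_{1..n}) (gt_old_global : global_ordering gt_old)
    (t : nat) (g : t.-tuple {mpoly K[n]})
    (g_sagbi : sagbi_basis gt_old A [set` g])
    (g_monic : monic_set gt_old [set` g])
    (w_new : 'rV[R]_n) (w_new_cone : sagbi_cone [set` g] gt_old w_new)
    (Mt : 'M[R]_n) (Mt_unit : Mt \in unitmx)
    (Mt_global : global_ordering (gt_mx Mt))
    (s : nat) (h : s.-tuple {mpoly K[n]})
    (h_sagbi : sagbi_basis (gt_weight w_new Mt)
                 (weight_initial_alg w_new [set` g]) [set` h])
    (h_monic : monic_set (gt_weight w_new Mt) [set` h]) :
  (forall j : 'I_s, exists P : {mpoly K[t]}, expresses w_new g P (tnth h j)) /\
  (forall P : 'I_s -> {mpoly K[t]},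
     (forall j, expresses w_new g (P j) (tnth h j)) ->
     sagbi_basis (gt_weight w_new Mt) A (range (fun j => P j \mPo g))).
Proof.
have w_ge0 := w_new_cone.1; have g_neq0 := monic_tuple_neq0 g_monic.
have gA i : A (tnth g i) by apply: g_sagbi.1; rewrite /= mem_tnth.
split=> [j|P PE].
  have hB : weight_initial_alg w_new [set` g] (tnth h j).
    by apply: h_sagbi.1; rewrite /= mem_tnth.
  have [p [f /= fg <-]|P hE] :=
    gen_alg_comp (g := [tuple of map (initial_form w_new) g]) _ hB.
    by have [i ->] := tnthP _ _ fg; exists i; rewrite tnth_map.
  have := @wdegp_wdeg_le _ _ _ w_new (tnth h j); rewrite {2}hE.
  move/(comp_init_truncate w_ge0) => [Q Qd QE].
  by exists Q; apply/expressesP => //; rewrite -QE.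
have PgA j : A (P j \mPo g) by exact: is_subalg_comp.
split=> [_ [j _ <-] //|]; apply/seteqP; split; last first.
  apply: gen_alg_min; first exact: gen_alg_is_subalg.
  move=> _ [_ [a [[j _ <-] lead ->]]]; apply: gen_alg_gen.
  by exists (P j \mPo g), a.
have lead_A : lead_monomials (gt_weight w_new Mt) A `<=`
    lead_monomials (gt_weight w_new Mt) (weight_initial_alg w_new [set` g]).
  move=> _ [f [a [Af lead ->]]].
  have fd := gt_weight_lead_wdeg_le lead.
  have [Q fE Qd] := subduction A_subalg gt_old_global g_sagbi g_monic
    w_new_cone Af fd.
  exists (Q \mPo [tuple of map (initial_form w_new) g]), a; split=> //.
    apply: is_subalg_comp => [|i]; first exact: gen_alg_is_subalg.
    apply: gen_alg_gen; exists (tnth g i); first by rewrite /= mem_tnth.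
    by rewrite tnth_map.
  apply: gt_weight_lead_transfer lead _ _; first exact: wdeg_le_comp_init.
  by rewrite fE; exact: (wpart_comp w_ge0 Qd).2.
have lead_h : lead_monomials (gt_weight w_new Mt) [set` h] `<=`
    lead_monomials (gt_weight w_new Mt) (range (fun j => P j \mPo g)).
  move=> _ [f [a [/= fh lead ->]]]; have [j fE] := tnthP _ _ fh; subst f.
  have /(expressesP w_ge0 g_neq0)[hE] := PE j.
  rewrite (wdegp_eq w_ge0 lead.1 (gt_weight_lead_wdeg_le lead)) => Pd.
  exists (P j \mPo g), a; split=> //.
  have [le_a partE] := wpart_comp w_ge0 Pd.
  by apply: gt_weight_lead_transfer lead le_a _; rewrite partE -hE.
apply: gen_alg_min => [|p /lead_A Bp]; first exact: gen_alg_is_subalg.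
have : initial_alg (gt_weight w_new Mt) [set` h] p.
  by rewrite /initial_alg -h_sagbi.2; exact: gen_alg_gen.
apply: gen_alg_min; first exact: gen_alg_is_subalg.
by move=> q /lead_h; exact: gen_alg_gen.
Qed.
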